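(* For every integer $m\ge5$, the Artin group $A_{I_2(m)}$ of type $I_2(m)$ is locally indicable.
   Context: $A_{I_2(m)}$ ($m\ge5$ an integer) is the group with generators $a_1,a_2$ and the single relation $\langle a_1a_2\rangle^m=\langle a_2a_1\rangle^m$, where $\langle ab\rangle^q=aba\cdots$ ($q$ factors). A group $G$ is locally indicable if every nontrivial finitely generated subgroup $H$ of $G$ admits a nontrivial homomorphism $H\to\mathbb{Z}$. *)

(* Defs.v *)
From HB Require Import structures.
From mathcomp Require Import all_boot all_order all_algebra.
From mathcomp Require Import boolp.

Set Implicit Arguments.
Unset Strict Implicit.
Unset Printing Implicit Defensive.

Local Open Scope group_scope.

(* Group words: the letter (x, false) stands for the generator x and
   (x, true) for its formal inverse. *)
Definition word (X : Type) := seq (X * bool).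

Definition inv_letter (X : Type) (l : X * bool) : X * bool := (l.1, ~~ l.2).

Definition inv_word (X : Type) (w : word X) : word X :=
  rev (map (@inv_letter X) w).

Definition pos_word (X : Type) (s : seq X) : word X :=
  [seq (x, false) | x <- s].

Section Presentation.
Variables (X : choiceType) (rels : seq (word X * word X)).

(* The congruence on words generated by free cancellation and by the relations
   u = v for (u, v) in rels; the presented group is its quotient. *)
Inductive pres_eq : word X -> word X -> Prop :=
| pres_refl u : pres_eq u u
| pres_sym u v : pres_eq u v -> pres_eq v u
| pres_trans u v w : pres_eq u v -> pres_eq v w -> pres_eq u w
| pres_cat u u' v v' : pres_eq u u' -> pres_eq v v' ->
    pres_eq (u ++ v) (u' ++ v')
| pres_cancel l : pres_eq [:: l; inv_letter l] [::]
| pres_rel u v : (u, v) \in rels -> pres_eq u v.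

Definition pres_eqb (u v : word X) : bool := `[< pres_eq u v >].

Lemma pres_eqb_refl : reflexive pres_eqb.
Proof. by move=> u; apply/asboolP/pres_refl. Qed.

Lemma pres_eqb_sym : symmetric pres_eqb.
Proof. by move=> u v; apply/asboolP/asboolP; apply: pres_sym. Qed.

Lemma pres_eqb_trans : transitive pres_eqb.
Proof.
by move=> v u w /asboolP uv /asboolP vw; apply/asboolP/(pres_trans uv vw).
Qed.

Canonical pres_equiv :=
  EquivRel pres_eqb pres_eqb_refl pres_eqb_sym pres_eqb_trans.

Definition presented : Type := {eq_quot pres_equiv}%qT.

HB.instance Definition _ := Choice.on presented.

Definition pres_class (w : word X) : presented := \pi_({eq_quot pres_equiv})%qT w.

Definition pres_repr (g : presented) : word X :=
  repr (g : {eq_quot pres_equiv}%qT).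

Lemma pres_classP u v : pres_class u = pres_class v <-> pres_eq u v.
Proof.
split=> [/eqP|uv]; last by apply/eqP; rewrite eqmodE; apply/asboolP.
by rewrite eqmodE => /asboolP.
Qed.

Lemma pres_reprK : cancel pres_repr pres_class.
Proof. exact: reprK. Qed.

Lemma pres_class_repr w : pres_eq (pres_repr (pres_class w)) w.
Proof. by apply/pres_classP; rewrite pres_reprK. Qed.

Lemma inv_letterK : involutive (@inv_letter X).
Proof. by case=> x b; rewrite /inv_letter /= negbK. Qed.

Lemma pres_mulVw w : pres_eq (inv_word w ++ w) [::].
Proof.
elim: w => [|l w IHw]; first exact: pres_refl.
rewrite /inv_word /= rev_cons cat_rcons.
apply: pres_trans IHw; apply: pres_cat; first exact: pres_refl.
have /= lK := pres_cat (pres_cancel (inv_letter l)) (pres_refl w).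
by rewrite inv_letterK in lK.
Qed.

Lemma inv_wordK : involutive (@inv_word X).
Proof.
move=> w; rewrite /inv_word map_rev revK -map_comp -[RHS]map_id.
by apply: eq_map => l; exact: inv_letterK.
Qed.

Lemma pres_mulwV w : pres_eq (w ++ inv_word w) [::].
Proof. by rewrite -{1}[w]inv_wordK; exact: pres_mulVw. Qed.

Definition pres_mul (g h : presented) := pres_class (pres_repr g ++ pres_repr h).

Definition pres_inv (g : presented) := pres_class (inv_word (pres_repr g)).

Lemma pres_mulE u v : pres_mul (pres_class u) (pres_class v) = pres_class (u ++ v).
Proof. by apply/pres_classP/pres_cat; apply: pres_class_repr. Qed.

Lemma pres_mulA : associative pres_mul.
Proof.
move=> g h k; rewrite -[g]pres_reprK -[h]pres_reprK -[k]pres_reprK.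
by rewrite !pres_mulE catA.
Qed.

Lemma pres_mul1 : left_id (pres_class [::]) pres_mul.
Proof. by move=> g; rewrite -[g]pres_reprK pres_mulE. Qed.

Lemma pres_mulg1 : right_id (pres_class [::]) pres_mul.
Proof. by move=> g; rewrite -[g]pres_reprK pres_mulE cats0. Qed.

Lemma pres_mulVg : left_inverse (pres_class [::]) pres_inv pres_mul.
Proof.
move=> g; rewrite -{2}[g]pres_reprK pres_mulE.
exact/pres_classP/pres_mulVw.
Qed.

Lemma pres_mulgV : right_inverse (pres_class [::]) pres_inv pres_mul.
Proof.
move=> g; rewrite -{1}[g]pres_reprK pres_mulE.
exact/pres_classP/pres_mulwV.
Qed.

HB.instance Definition _ := isGroup.Build presented
  pres_mulA pres_mul1 pres_mulg1 pres_mulVg pres_mulgV.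

End Presentation.

(* alternating a b q is the word a b a ... with q factors. *)
Fixpoint alternating (X : Type) (a b : X) (q : nat) : seq X :=
  if q is q'.+1 then a :: alternating b a q' else [::].

(* The generators a_1, a_2 are the elements 0, 1 of 'I_2. *)
Definition artin_I2 (m : nat) : groupType :=
  let a1 : 'I_2 := ord0 in
  let a2 : 'I_2 := ord_max in
  presented [:: (pos_word (alternating a1 a2 m), pos_word (alternating a2 a1 m))].

(* With classical choice in force, a boolean predicate on G is the same thing
   as an arbitrary subset of G. *)
Definition finitely_generated (G : groupType) (H : {pred G}) : Prop :=
  exists s : seq G, {subset s <= H} /\
    forall K : {pred G}, group_closed K -> {subset s <= K} -> {subset H <= K}.

(* A homomorphism H -> Z is given by the values on H of a function on G. *)
Definition locally_indicable (G : groupType) : Prop :=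
  forall H : {pred G},
    group_closed H -> finitely_generated H -> (exists2 x, x \in H & x != 1) ->
    exists f : G -> int,
      {in H &, {morph f : x y / x * y >-> (x + y)%R}} /\
      (exists2 x, x \in H & f x != 0%R).

(* Main.v *)
Require Import Defs.
From HB Require Import structures.
From mathcomp Require Import all_boot all_order all_algebra.
From mathcomp Require Import boolp zify ring.

Set Implicit Arguments.
Unset Strict Implicit.
Unset Printing Implicit Defensive.

Import GRing.Theory Num.Theory.
Local Open Scope group_scope.

(* Let len : A -> Z send both generators to 1. A subgroup on which len does not
   vanish is mapped nontrivially to Z by len, so it remains to treat subgroups of
   ker len, and this kernel is free of rank m - 1: writing <ab>^q for the
   alternating word, a basis is d_q = <a_1 a_2>^q a_1^-q for q even and
   d_q = <a_2 a_1>^q a_1^-q for q odd, 1 <= q < m. Conjugation by a_1 maps d_q to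
   d_(q+1) for q odd and to d_1^-1 d_(q+1) for q even, and the defining relation
   amounts to d_m = d_(m-1). Hence A acts on the free group F on d_1, ..., d_(m-1),
   with a_1 acting through the conjugation and a_2 = d_1 a_1; the orbit map
   g |-> g . 1 is an injective homomorphism from ker len to F.
   In the Magnus representation x |-> 1 + x of F on power series, the coefficient
   of a monomial of lowest positive degree occurring in a nontrivial subgroup is a
   nonzero homomorphism on that subgroup. *)

(** * Actions of a presented group *)

Section PresentedGroup.
Variables (X : choiceType) (rels : seq (word X * word X)).
Local Notation G := (presented rels).

Definition pres_gen (x : X) : G := pres_class rels [:: (x, false)].

Lemma pres_class_cat u v :
  pres_class rels (u ++ v) = pres_class rels u * pres_class rels v.
Proof. by rewrite -pres_mulE. Qed.

Lemma pres_class_letter x b :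
  pres_class rels [:: (x, b)] = if b then (pres_gen x)^-1 else pres_gen x.
Proof.
case: b => //; apply/esym/mulg1_eq; rewrite -pres_class_cat.
exact/pres_classP/(pres_cancel _ (x, false)).
Qed.

Lemma pres_ind (P : G -> Prop) :
  P 1 -> (forall x g, P g -> P (pres_gen x * g)) ->
  (forall x g, P g -> P ((pres_gen x)^-1 * g)) -> forall g, P g.
Proof.
move=> P1 PM PV g; rewrite -[g]pres_reprK.
elim: (pres_repr g) => [|[x b] w IHw]; first exact: P1.
rewrite -cat1s pres_class_cat pres_class_letter.
by case: b; [apply: PV | apply: PM].
Qed.

Section Action.
Variables (T : Type) (e : X * bool -> T -> T).
Hypothesis eK : forall l, cancel (e (inv_letter l)) (e l).
Hypothesis e_rel : forall u v, (u, v) \in rels -> forall y, foldr e y u = foldr e y v.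

Definition pres_act (g : G) (y : T) : T := foldr e y (pres_repr g).

(** Cancellation is respected by [eK] and the relations by [e_rel], so the action does not depend on
    the representative chosen in [pres_act]. *)
Lemma pres_act_class w y : pres_act (pres_class rels w) y = foldr e y w.
Proof.
rewrite /pres_act; have := pres_class_repr rels w.
move: (pres_repr _) => u uw; elim: uw y => {u w} //.
- by move=> u v w _ IH1 _ IH2 y; rewrite IH1.
by move=> u u' v v' _ IHu _ IHv y; rewrite !foldr_cat IHv IHu.
Qed.

Lemma pres_act1 y : pres_act 1 y = y.
Proof. exact: pres_act_class [::] y. Qed.

Lemma pres_actM g h y : pres_act (g * h) y = pres_act g (pres_act h y).
Proof.
rewrite -[g]pres_reprK -[h]pres_reprK -pres_class_cat.
by rewrite !pres_act_class foldr_cat.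
Qed.

Lemma pres_act_gen x y : pres_act (pres_gen x) y = e (x, false) y.
Proof. exact: pres_act_class. Qed.

Lemma pres_act_genV x y : pres_act (pres_gen x)^-1 y = e (x, true) y.
Proof. by rewrite -(pres_class_letter x true) pres_act_class. Qed.

End Action.
End PresentedGroup.

(** * Free groups and their universal property *)

Section FreeGroup.
Variable X : choiceType.

Definition free_group : groupType := presented (X := X) [::].
Definition free_gen : X -> free_group := pres_gen [::].

Variables (G : groupType) (h : X -> G).

Let e (l : X * bool) (y : G) := (if l.2 then (h l.1)^-1 else h l.1) * y.

Let eK l : cancel (e (inv_letter l)) (e l).
Proof.
by case: l => x [] y; rewrite /e /= mulgA ?mulVg ?mulgV mul1g.
Qed.

(** The free group acts on [G] by left multiplication through [h]; the lift is the orbit map of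
    1. *)
Definition free_lift (g : free_group) : G := pres_act e g 1.

Let free_rel u v : (u, v) \in [::] -> forall y, foldr e y u = foldr e y v.
Proof. by []. Qed.

Lemma free_liftM : {morph free_lift : g g' / g * g'}.
Proof.
move=> g g'; rewrite /free_lift pres_actM //; move: (pres_act e g' 1) => y.
elim/pres_ind: g => [|x g IHg|x g IHg].
- by rewrite !pres_act1 // mul1g.
- by rewrite !(pres_actM eK free_rel) !(pres_act_gen eK free_rel) /e /= IHg mulgA.
- by rewrite !(pres_actM eK free_rel) !(pres_act_genV eK free_rel) /e /= IHg mulgA.
Qed.

Lemma free_lift1 : free_lift 1 = 1. Proof. exact: pres_act1. Qed.

Lemma free_lift_gen x : free_lift (free_gen x) = h x.
Proof. by rewrite /free_lift (pres_act_gen eK) // /e mulg1. Qed.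

HB.instance Definition _ :=
  isUMagmaMorphism.Build free_group G free_lift (free_lift1, free_liftM).

End FreeGroup.

(** * The Magnus representation of a free group *)

Section Magnus.
Variable X : choiceType.
(* Formal power series over Z in non-commuting variables X, given by their
   coefficients on the monomials. *)
Local Notation series := (seq X -> int).

(* Multiplication of f by 1 + x on the left; magnus_div divides by 1 + x. *)
Definition magnus_mul (x : X) (f : series) : series := fun w =>
  (f w + if w is y :: w' then if y == x then f w' else 0 else 0)%R.

Fixpoint magnus_div (x : X) (f : series) (w : seq X) : int :=
  (f w - if w is y :: w' then if y == x then magnus_div x f w' else 0 else 0)%R.

Definition magnus_letter (l : X * bool) : series -> series :=
  if l.2 then magnus_div l.1 else magnus_mul l.1.

Lemma magnus_mulK x : cancel (magnus_mul x) (magnus_div x).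
Proof.
move=> f; apply/funext; elim=> [|y w IHw] /=; first by rewrite /magnus_mul; ring.
by rewrite /magnus_mul; case: eqP => _; rewrite ?IHw; ring.
Qed.

Lemma magnus_divK x : cancel (magnus_div x) (magnus_mul x).
Proof.
move=> f; apply/funext; case=> [|y w]; rewrite /magnus_mul /=; first by ring.
by case: eqP => _; ring.
Qed.

Lemma magnus_letterK l : cancel (magnus_letter (inv_letter l)) (magnus_letter l).
Proof. by case: l => x []; [apply: magnus_mulK | apply: magnus_divK]. Qed.

Definition series1 : series := fun w => (nilp w)%:R%R.

Definition magnus (g : free_group X) : series := pres_act magnus_letter g series1.

(** The Cauchy product, over all splittings of [w] into a prefix and a suffix. *)
Fixpoint series_mul (f h : series) (w : seq X) : int :=
  (f [::] * h w +
   if w is x :: w' then series_mul (fun v => f (x :: v)) h w' else 0)%R.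

Lemma series_mul0 h w : series_mul (fun=> 0%R) h w = 0%R.
Proof. by elim: w => [|x w IHw] /=; rewrite ?IHw; ring. Qed.

Lemma series_mul1 h : series_mul series1 h = h.
Proof.
apply/funext; case=> [|x w] /=; rewrite /series1 /=; first by ring.
by rewrite series_mul0; ring.
Qed.

Lemma series_mulD f f' h w :
  series_mul (fun v => f v + f' v)%R h w = (series_mul f h w + series_mul f' h w)%R.
Proof.
by elim: w f f' => [|x w IHw] f f' /=; rewrite ?IHw; ring.
Qed.

Lemma magnus_mul_series_mul x f h :
  magnus_mul x (series_mul f h) = series_mul (magnus_mul x f) h.
Proof.
apply/funext; case=> [|y w]; rewrite /magnus_mul /=; first by ring.
by rewrite series_mulD; case: eqP => _; rewrite ?series_mul0; ring.
Qed.

Lemma magnus_div_series_mul x f h :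
  magnus_div x (series_mul f h) = series_mul (magnus_div x f) h.
Proof.
apply: (can_inj (@magnus_mulK x)).
by rewrite magnus_divK magnus_mul_series_mul magnus_divK.
Qed.

Let free_rel u v : (u, v) \in [::] ->
  forall f, foldr magnus_letter f u = foldr magnus_letter f v.
Proof. by []. Qed.

Let actE := (pres_actM magnus_letterK free_rel, pres_act1 magnus_letterK free_rel,
  pres_act_gen magnus_letterK free_rel, pres_act_genV magnus_letterK free_rel).

Lemma magnusM g h : magnus (g * h) = series_mul (magnus g) (magnus h).
Proof.
rewrite /magnus actE; move: (pres_act _ h _) => f.
elim/pres_ind: g => [|x g IHg|x g IHg]; rewrite !actE ?series_mul1 //= IHg.
- exact: magnus_mul_series_mul.
- exact: magnus_div_series_mul.
Qed.

Lemma magnus_nil g : magnus g [::] = 1%R.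
Proof.
rewrite /magnus; elim/pres_ind: g => [|x g IHg|x g IHg]; rewrite actE //.
- by rewrite actE /= /magnus_letter /magnus_mul /= addr0.
- by rewrite actE /= /magnus_letter /= subr0.
Qed.

Lemma series_mul_lowest f h w :
  (forall v, size v < size w -> f v = 0%R) -> series_mul f h w = (f w * h [::])%R.
Proof.
elim: w f => [|x w IHw] f f0 /=; first by rewrite addr0.
by rewrite f0 // mul0r add0r IHw // => v vw; apply: f0.
Qed.

(** Only the empty and the full prefix of [w] contribute, and constant coefficients are 1. *)
Lemma magnusM_lowest g h w : w != [::] ->
  (forall v, v != [::] -> size v < size w -> magnus g v = 0%R) ->
  magnus (g * h) w = (magnus g w + magnus h w)%R.
Proof.
case: w => // x w _ g0; rewrite magnusM /= magnus_nil series_mul_lowest.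
  by rewrite magnus_nil; ring.
by move=> v vw; apply: g0.
Qed.

(** * Faithfulness of the Magnus representation *)

Local Notation neq := (fun x y : X => x != y).

Lemma magnus_letter_neq x b f v : path neq x v ->
  magnus_letter (x, b) f v = f v.
Proof.
case: v => [|y v] /=; first by case: b; rewrite /= /magnus_letter /magnus_mul /= ?subr0 ?addr0.
rewrite eq_sym => /andP[/negPf yx _].
by case: b; rewrite /= /magnus_letter /magnus_mul /= yx ?subr0 ?addr0.
Qed.

(** As [v] does not begin with [x], only the terms of degree at most 1 of 1 + x or its inverse
    contribute. *)
Lemma magnus_letter_cons x b f v : path neq x v ->
  magnus_letter (x, b) f (x :: v) = (f (x :: v) + (-1) ^+ b * f v)%R.
Proof.
move=> xv; have := magnus_letter_neq b f xv.
case: b; rewrite /magnus_letter /magnus_mul /= eqxx; last by move=> _; ring.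
by move=> ->; ring.
Qed.

(* Satisfied by the image f of a reduced word that starts with the letter (x, b)
   and whose syllables are nonzero powers of the successive elements of x :: s.
   The last two clauses bound the length of the monomials without repeated
   adjacent variables that occur in f. *)
Definition syllable_inv (f : series) (x : X) (b : bool) (s : seq X) : Prop :=
  [/\ path neq x s, f s != 0%R,
   exists n : nat, f (x :: s) = ((-1) ^+ b * n.+1%:R * f s)%R,
   forall v, path neq x v -> size s < size v -> f v = 0%R &
   forall v, sorted neq v -> (size s).+1 < size v -> f v = 0%R].

Lemma syllable_inv_same f x b s :
  syllable_inv f x b s -> syllable_inv (magnus_letter (x, b) f) x b s.
Proof.
move=> [xs fs [n fxs] f1 f2]; split=> //.
- by rewrite magnus_letter_neq.
- exists n.+1; rewrite magnus_letter_cons // magnus_letter_neq // fxs.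
  by rewrite [in RHS]mulrSr; ring.
- by move=> v xv sv; rewrite magnus_letter_neq // f1.
move=> [|y v] // yv sv; have [eyx|nyx] := eqVneq y x.
  by rewrite eyx magnus_letter_cons -?eyx // f2 // f1 -?eyx //; ring.
by rewrite magnus_letter_neq ?f2 //= eq_sym nyx.
Qed.

Lemma syllable_inv_new f x b s :
  path neq x s -> f s != 0%R ->
  (forall v, sorted neq v -> size s < size v -> f v = 0%R) ->
  syllable_inv (magnus_letter (x, b) f) x b s.
Proof.
move=> xs fs f0; split=> //.
- by rewrite magnus_letter_neq.
- by exists 0; rewrite magnus_letter_cons // magnus_letter_neq // f0 //=; ring.
- by move=> v xv sv; rewrite magnus_letter_neq // f0 // (path_sorted xv).
move=> [|y v] // yv sv; have [eyx|nyx] := eqVneq y x.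
  rewrite eyx magnus_letter_cons -?eyx // !f0 ?(path_sorted yv) //; first by ring.
  exact: ltnW.
by rewrite magnus_letter_neq ?f0 //=; [apply: ltnW | rewrite eq_sym nyx].
Qed.

Definition reduced (w : word X) := sorted (fun k l => l != inv_letter k) w.

(** A letter either prolongs the first syllable, with the same sign because the word is reduced, or
    opens a new one in a different variable. *)
Lemma reduced_syllable_inv x b w : reduced ((x, b) :: w) ->
  exists s, syllable_inv (foldr magnus_letter series1 ((x, b) :: w)) x b s.
Proof.
elim: w x b => [|[y c] w IHw] x b red.
  exists [::]; apply: syllable_inv_new => //.
  by move=> [|y v].
move: red => /= /andP[yx yw]; set f := magnus_letter (y, c) _.
have [s fs] : exists s, syllable_inv f y c s := IHw y c yw.
have [exy|nxy] := eqVneq y x.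
  have ebc : c = b.
    by move: yx; rewrite exy /inv_letter /= xpair_eqE eqxx; case: (b); case: (c).
  by exists s; rewrite -exy -ebc; apply: syllable_inv_same.
exists (y :: s); case: fs => ys fs0 [n fys] f1 f2; apply: syllable_inv_new => //.
- by rewrite /= eq_sym nxy.
- by rewrite fys !mulf_eq0 signr_eq0 pnatr_eq0.
Qed.

Lemma reduced_repr (g : free_group X) :
  exists2 w, reduced w & g = pres_class [::] w.
Proof.
elim/pres_ind: g => [|x g [w wr ->]|x g [w wr ->]]; first by exists [::].
- case: w wr => [|[y c] w] wr.
    by exists [:: (x, false)]; rewrite // -pres_class_cat.
  have [eyc|nyc] := eqVneq (y, c) (x, true); last first.
    by exists [:: (x, false), (y, c) & w] => //=; rewrite ?nyc // -pres_class_cat.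
  exists w; first exact: path_sorted wr.
  by rewrite -cat1s pres_class_cat eyc pres_class_letter mulVKg.
- case: w wr => [|[y c] w] wr.
    by exists [:: (x, true)]; rewrite // -(pres_class_letter _ x true) -pres_class_cat.
  have [eyc|nyc] := eqVneq (y, c) (x, false); last first.
    exists [:: (x, true), (y, c) & w] => //=; rewrite ?nyc //.
    by rewrite -(pres_class_letter _ x true) -pres_class_cat.
  exists w; first exact: path_sorted wr.
  by rewrite -cat1s pres_class_cat eyc pres_class_letter mulKg.
Qed.

Lemma magnus_neq0 g : g != 1 -> exists2 v, v != [::] & magnus g v != 0%R.
Proof.
have [[|[x b] w] wr ->] := reduced_repr g; first by rewrite eqxx.
have [s [_ fs [n fxs] _ _]] := reduced_syllable_inv wr; exists (x :: s) => //.
rewrite /magnus (pres_act_class magnus_letterK free_rel) fxs.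
by rewrite !mulf_eq0 signr_eq0 pnatr_eq0.
Qed.

(* If w is a monomial of lowest positive degree occurring in the images of the
   elements of H, then products of two terms of positive degree do not contribute
   to the coefficient of w, which is therefore additive on H. *)
Theorem free_subgroup_hom (H : {pred free_group X}) :
  group_closed H -> (exists2 x, x \in H & x != 1) ->
  exists f : free_group X -> int,
    {in H &, {morph f : x y / x * y >-> (x + y)%R}} /\
    (exists2 x, x \in H & f x != 0%R).
Proof.
move=> Hcl [g0 g0H g0n1].
pose P d := `[< exists2 g, g \in H & exists v,
  [/\ v != [::], size v = d & magnus g v != 0%R] >].
have exP : exists d, P d.
  have [v vn gv] := magnus_neq0 g0n1.
  by exists (size v); apply/asboolP; exists g0 => //; exists v.
case: (ex_minnP exP) => _ /asboolP[g gH [w [wn <- gw]]] dmin.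
exists (fun h => magnus h w); split; last by exists g.
move=> h k hH _; apply: magnusM_lowest => // v vn; apply: contraTeq => hv.
by rewrite -leqNgt; apply/dmin/asboolP; exists h => //; exists v.
Qed.

End Magnus.

(** * Integer iterates of a bijection *)

Section IntIter.
Variables (T : Type) (f f' : T -> T).
Hypotheses (fK : cancel f f') (f'K : cancel f' f).

Definition int_iter (k : int) (x : T) : T :=
  match k with Posz n => iter n f x | Negz n => iter n.+1 f' x end.

Lemma int_iterS k x : int_iter (k + 1)%R x = f (int_iter k x).
Proof.
case: k => [n|[|n]].
- by have -> : (Posz n + 1)%R = Posz n.+1 by lia.
- by rewrite /= f'K.
have -> : (Negz n.+1 + 1)%R = Negz n by lia.
by rewrite /= f'K.
Qed.

Lemma int_iterP k x : int_iter (k - 1)%R x = f' (int_iter k x).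
Proof. by rewrite -[k in RHS](subrK 1%R) int_iterS fK. Qed.

End IntIter.

(** * The length kernel of a dihedral Artin group *)

Section DihedralArtin.
(* k.+2 is the rank of the kernel of the length, and m = k.+3. *)
Variable k : nat.
Local Notation F := (free_group 'I_k.+2).
Local Notation G := (artin_I2 k.+3).

(* The basis d_1, ..., d_(k.+2), with the conventions d_0 = 1 and
   d_(k.+3) = d_(k.+2). *)
Definition fgen (q : nat) : F :=
  if q is i.+1 then free_gen (inord (minn i k.+1)) else 1.
Local Notation D := fgen.

Lemma fgen_last : D k.+3 = D k.+2.
Proof. by rewrite /fgen minnn (minn_idPr _). Qed.

Lemma free_gen_fgen (i : 'I_k.+2) : free_gen i = D i.+1.
Proof. by rewrite /fgen (minn_idPl _) ?inord_val // -ltnS. Qed.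

Arguments fgen : simpl never.

(* The automorphism of the kernel induced by conjugation by a_1. *)
Definition monodromy : F -> F :=
  free_lift (fun i : 'I_k.+2 => (if odd i then (D 1)^-1 else 1) * D i.+2).

(* d_1 is read off from monodromy d_(k.+1) and monodromy d_(k.+2), exactly one
   of which is d_1^-1 d_(k.+2), the other being d_(k.+2). *)
Definition monodromy_inv_fgen1 : F :=
  if odd k then D k.+2 / D k.+1 else D k.+1 / D k.+2.

Definition monodromy_inv : F -> F :=
  free_lift (fun i : 'I_k.+2 => (if odd i then 1 else monodromy_inv_fgen1) * D i).

HB.instance Definition _ := UMagmaMorphism.on monodromy.
HB.instance Definition _ := UMagmaMorphism.on monodromy_inv.

Lemma monodromy_fgen q : q <= k.+2 ->
  monodromy (D q) = (if odd q then 1 else (D 1)^-1) * D q.+1.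
Proof.
case: q => [|q] qk; first by rewrite gmulf1 mulVg.
rewrite {1}/fgen (minn_idPl _) // /monodromy free_lift_gen inordK //=.
by case: (odd q).
Qed.

Lemma monodromy_inv_fgen q : q <= k.+1 ->
  monodromy_inv (D q.+1) = (if odd q then 1 else monodromy_inv_fgen1) * D q.
Proof.
by move=> qk; rewrite {1}/fgen (minn_idPl _) // /monodromy_inv free_lift_gen inordK.
Qed.

Lemma monodromy_inv_fgen1E : monodromy_inv (D 1) = monodromy_inv_fgen1.
Proof. by rewrite monodromy_inv_fgen // mulg1. Qed.

Lemma monodromy_monodromy_inv_fgen1 : monodromy monodromy_inv_fgen1 = D 1.
Proof.
rewrite /monodromy_inv_fgen1.
by case: ifP => ok; rewrite gmulfF /= !monodromy_fgen // fgen_last /= ok;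
  rewrite /= ?mul1g ?invgM ?invgK ?mulgA ?mulgV ?mul1g ?mulgVK.
Qed.

Lemma monodromy_invK : cancel monodromy_inv monodromy.
Proof.
move=> g; have genK i : monodromy (monodromy_inv (free_gen i)) = free_gen i.
  have ik : i <= k.+1 by rewrite -ltnS.
  rewrite free_gen_fgen monodromy_inv_fgen // gmulfM /= monodromy_fgen; last exact: leqW.
  by case: (odd i); rewrite ?gmulf1 ?mul1g // monodromy_monodromy_inv_fgen1 mulVKg.
elim/pres_ind: g => [|i g IHg|i g IHg]; rewrite ?gmulf1 // !gmulfM /= IHg ?gmulfV /=.
- by congr (_ * _); apply: genK.
- by congr (_^-1 * _); apply: genK.
Qed.

Lemma monodromyK : cancel monodromy monodromy_inv.
Proof.
move=> g; have genK i : monodromy_inv (monodromy (free_gen i)) = free_gen i.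
  rewrite free_gen_fgen monodromy_fgen // gmulfM /=.
  (* The image of the last generator involves [D k.+3], which must first be turned into [D k.+2]. *)
  have := ltn_ord i; rewrite ltnS leq_eqVlt => /orP[/eqP ->|ik].
    rewrite fgen_last !monodromy_inv_fgen //= negbK /monodromy_inv_fgen1.
    case: ifP => ok; rewrite ?gmulf1 ?mul1g ?mulgVK // gmulfV /= monodromy_inv_fgen1E.
    by rewrite /monodromy_inv_fgen1 ok invgF mulgVK.
  rewrite monodromy_inv_fgen //=.
  by case: (odd i); rewrite /= ?gmulf1 ?gmulfV /= ?monodromy_inv_fgen1E ?mul1g ?mulKg.
elim/pres_ind: g => [|i g IHg|i g IHg]; rewrite ?gmulf1 // !gmulfM /= IHg ?gmulfV /=.
- by congr (_ * _); apply: genK.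
- by congr (_^-1 * _); apply: genK.
Qed.

(** * The length and the action on the free group *)

Local Notation alt_word a b q := (pos_word (alternating (a : 'I_2) (b : 'I_2) q)).

Definition artin_rels :=
  [:: (alt_word ord0 ord_max k.+3, alt_word ord_max ord0 k.+3)].
Local Notation rels := artin_rels.

Lemma artin_rel_ind (P : word 'I_2 -> word 'I_2 -> Prop) :
  P (alt_word ord0 ord_max k.+3) (alt_word ord_max ord0 k.+3) ->
  forall u v, (u, v) \in rels -> P u v.
Proof. by move=> Pr u v; rewrite inE => /eqP[-> ->]. Qed.

Definition len_letter (l : 'I_2 * bool) (z : int) : int :=
  (if l.2 then z - 1 else z + 1)%R.

Lemma len_letterK l : cancel (len_letter (inv_letter l)) (len_letter l).
Proof. by case: l => x [] z; rewrite /len_letter /=; ring. Qed.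

Lemma len_letter_rel u v : (u, v) \in rels ->
  forall z, foldr len_letter z u = foldr len_letter z v.
Proof.
have lenE (s : seq 'I_2) z : foldr len_letter z (pos_word s) = (z + (size s)%:R)%R.
  by elim: s => [|x s IHs] /=; [rewrite addr0 | rewrite IHs /len_letter /= -addrA -natr1].
have sizeE (a b : 'I_2) q : size (alternating a b q) = q.
  by elim: q a b => //= q IHq a b; rewrite IHq.
by move: u v; apply: artin_rel_ind => z; rewrite !lenE !sizeE.
Qed.

Definition artin_len (g : G) : int := pres_act len_letter g 0%R.

(* a_1 acts by the monodromy, and a_2 = d_1 a_1 by the monodromy followed by
   left translation by d_1. *)
Definition fiber_letter (l : 'I_2 * bool) (y : F) : F :=
  let d := if l.1 == ord0 then 1 else D 1 in
  if l.2 then monodromy_inv (d^-1 * y) else d * monodromy y.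

Lemma fiber_letterK l : cancel (fiber_letter (inv_letter l)) (fiber_letter l).
Proof.
case: l => x [] y; rewrite /fiber_letter /=.
  by rewrite mulKg monodromyK.
by rewrite monodromy_invK mulVKg.
Qed.

(** A word ending in a_1 has the same translation part as the word without that letter, whence the
    index q - 1. For q = 0 truncated subtraction gives d_0 = 1. *)
Lemma fiber_alternating q : q <= k.+3 ->
  (forall y, foldr fiber_letter y (alt_word ord0 ord_max q) =
     D (q - odd q) * iter q monodromy y) /\
  (forall y, foldr fiber_letter y (alt_word ord_max ord0 q) =
     D (q - ~~ odd q) * iter q monodromy y).
Proof.
elim: q => [|q IHq] qk; first by split=> y; rewrite mul1g.
have [IH0 IH1] := IHq (ltnW qk).
split=> y; rewrite /= ?IH0 ?IH1 /fiber_letter /= ?mul1g gmulfM /= ?mulgA; congr (_ * _).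
  case: q qk {IHq IH0 IH1} => [|q] qk; first by rewrite gmulf1.
  by rewrite /= !negbK; case oq: (odd q);
    rewrite ?subn1 ?subn0 monodromy_fgen /= ?oq ?mul1g // ltnW.
case: q qk {IHq IH0 IH1} => [|q] qk; first by rewrite gmulf1 mulg1.
by rewrite /= !negbK; case oq: (odd q);
  rewrite /= ?subn1 ?subn0 monodromy_fgen /= ?oq ?mulVKg // ltnW.
Qed.

(** The two sides translate by d_(k.+3) and d_(k.+2), in an order depending on parity, and these
    coincide. *)
Lemma fiber_letter_rel u v : (u, v) \in rels ->
  forall y, foldr fiber_letter y u = foldr fiber_letter y v.
Proof.
have [alt0 alt1] := fiber_alternating (leqnn _).
move: u v; apply: artin_rel_ind => y; rewrite alt0 alt1; congr (_ * _).
by case: (odd k.+3); rewrite subn0 subn1 fgen_last.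
Qed.

Arguments alternating : simpl never.

Definition fiber_act : G -> F -> F := pres_act fiber_letter.

Definition fiber (g : G) : F := fiber_act g 1.

Local Notation t := (pres_gen rels ord0 : G).
Local Notation s := (pres_gen rels ord_max : G).
Local Notation alt a b q := (pres_class rels (alt_word a b q) : G).

Let lenE := (pres_actM len_letterK len_letter_rel, pres_act1 len_letterK len_letter_rel,
  pres_act_gen len_letterK len_letter_rel, pres_act_genV len_letterK len_letter_rel).
Let fiberE := (pres_actM fiber_letterK fiber_letter_rel,
  pres_act1 fiber_letterK fiber_letter_rel,
  pres_act_gen fiber_letterK fiber_letter_rel,
  pres_act_genV fiber_letterK fiber_letter_rel).

Lemma artin_ind (P : G -> Prop) :
  P 1 -> (forall g, P g -> P (t * g)) -> (forall g, P g -> P (t^-1 * g)) ->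
  (forall g, P g -> P (s * g)) -> (forall g, P g -> P (s^-1 * g)) -> forall g, P g.
Proof.
move=> P1 Pt Ptv Ps Psv; have I2 (x : 'I_2) : x = ord0 \/ x = ord_max.
  by case: x => [[|[|//]] i]; [left | right]; apply: val_inj.
apply: pres_ind => // x g Pg; have [->|->] := I2 x.
- exact: Pt.
- exact: Ps.
- exact: Ptv.
- exact: Psv.
Qed.

Lemma artin_lenM g h : artin_len (g * h) = (artin_len g + artin_len h)%R.
Proof.
rewrite /artin_len lenE; move: (pres_act _ h _) => z.
by elim/pres_ind: g => [|x g IHg|x g IHg]; rewrite !lenE ?add0r // IHg /len_letter /=; ring.
Qed.

(** The action factors through the semidirect product of [F] and Z: a power of the monodromy, then a
    left translation. *)
Lemma fiber_actE g y :
  fiber_act g y = fiber g * int_iter monodromy monodromy_inv (artin_len g) y.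
Proof.
rewrite /fiber /fiber_act /artin_len.
by elim/artin_ind: g y => [|g IHg|g IHg|g IHg|g IHg] y; rewrite !lenE !fiberE /=
  ?mul1g // IHg /fiber_letter /len_letter /= ?invg1 ?mul1g
  ?(int_iterS monodromy_invK) ?(int_iterP monodromyK monodromy_invK) ?gmulfM ?mulgA.
Qed.

Lemma fiberM g h : artin_len g = 0%R -> fiber (g * h) = fiber g * fiber h.
Proof. by move=> g0; rewrite {1}/fiber /fiber_act fiberE [LHS]fiber_actE g0. Qed.

(** * The free generators as elements of the Artin group *)

Definition fiber_basis (q : nat) : G :=
  (if odd q then alt ord_max ord0 q else alt ord0 ord_max q) * t ^- q.

Lemma alt_cons a b q : alt a b q.+1 = pres_gen rels a * alt b a q.
Proof. by rewrite -pres_class_cat. Qed.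

Lemma alt_rcons a b q :
  alt a b q.+1 = alt a b q * pres_gen rels (if odd q then b else a).
Proof.
elim: q a b => [|q IHq] a b; first by rewrite -pres_class_cat.
by rewrite alt_cons IHq alt_cons mulgA /=; case: (odd q).
Qed.

(** For q odd, a_1 prolongs the alternating word; for q even, a_1 = d_1^-1 a_2 and a_2 prolongs
    it. *)
Lemma fiber_basis_conj q :
  t * fiber_basis q * t^-1 = (if odd q then 1 else (fiber_basis 1)^-1) * fiber_basis q.+1.
Proof.
rewrite /fiber_basis -!mulgA -invgM -expgS !oddS !alt_cons; case: (odd q) => /=.
  by rewrite mul1g mulgA.
by rewrite mulg1 invgM invgK !mulgA mulgVK.
Qed.

(** By the relation, the longest alternating word can be taken to end in a_1, which cancels against
    the power of a_1. *)
Lemma fiber_basis_last : fiber_basis k.+3 = fiber_basis k.+2.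
Proof.
have rel : alt ord0 ord_max k.+3 = alt ord_max ord0 k.+3.
  by apply/pres_classP/pres_rel; rewrite inE.
rewrite /fiber_basis [in LHS]expgSr invgM -rel if_same.
by case: ifP => ok; [rewrite rel|]; rewrite alt_rcons ok mulgA mulgK.
Qed.

Definition fiber_incl : F -> G := free_lift (fun i : 'I_k.+2 => fiber_basis i.+1).

HB.instance Definition _ := UMagmaMorphism.on fiber_incl.

Lemma fiber_incl_fgen q : q <= k.+3 -> fiber_incl (D q) = fiber_basis q.
Proof.
have fgenE p : p <= k.+2 -> fiber_incl (D p) = fiber_basis p.
  case: p => [|p] pk; first by rewrite gmulf1 /fiber_basis /= mul1g invg1.
  by rewrite /fgen (minn_idPl _) // /fiber_incl free_lift_gen inordK.
rewrite leq_eqVlt => /orP[/eqP->|]; last exact: fgenE.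
by rewrite fgen_last fgenE // fiber_basis_last.
Qed.

Lemma fiber_incl_monodromy y : fiber_incl (monodromy y) = t * fiber_incl y * t^-1.
Proof.
have genE i : fiber_incl (monodromy (free_gen i)) = t * fiber_incl (free_gen i) * t^-1.
  have ik := ltn_ord i.
  rewrite free_gen_fgen monodromy_fgen // gmulfM /= !fiber_incl_fgen //; last exact: leqW.
  rewrite fiber_basis_conj; congr (_ * _).
  by rewrite oddS; case: (odd i); rewrite /= ?gmulf1 ?gmulfV //= ?fiber_incl_fgen.
elim/pres_ind: y => [|i y IHy|i y IHy].
- by rewrite !gmulf1 mulg1 mulgV.
- by rewrite !gmulfM /= IHy [fiber_incl _]genE !mulgA mulgVK.
- by rewrite !gmulfM !gmulfV /= IHy [fiber_incl _]genE !invgM invgK !mulgA mulgVK.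
Qed.

Lemma fiber_incl_monodromy_inv y :
  fiber_incl (monodromy_inv y) = t^-1 * fiber_incl y * t.
Proof. by rewrite -[y in RHS]monodromy_invK fiber_incl_monodromy !mulgA mulVg mul1g mulgVK. Qed.

(** Fiber and length together determine [g], which gives injectivity on the kernel of the length.
    The induction on letters uses a_2 = d_1 a_1. *)
Lemma fiber_incl_fiber g :
  g = fiber_incl (fiber g) * int_iter ( *%g t) ( *%g t^-1) (artin_len g) 1.
Proof.
have s1 : fiber_incl (D 1) = s * t^-1.
  by rewrite fiber_incl_fgen // /fiber_basis /= alt_cons mulg1 expg1.
rewrite /fiber /fiber_act /artin_len.
elim/artin_ind: g => [|g IHg|g IHg|g IHg|g IHg]; rewrite !lenE !fiberE ?gmulf1 ?mul1g //
  {1}IHg /fiber_letter /len_letter /= ?invg1 ?mul1g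
  ?(int_iterS (mulVKg t)) ?(int_iterP (mulKg t) (mulVKg t))
  ?gmulfM /= ?gmulfV /= ?fiber_incl_monodromy ?fiber_incl_monodromy_inv ?gmulfM /= ?gmulfV /=
  ?s1 ?invgM ?invgK !mulgA ?mulgVK ?mulgK ?mulVg ?mulgV ?mul1g //.
Qed.

Lemma fiber_inj g : artin_len g = 0%R -> fiber g = 1 -> g = 1.
Proof. by move=> g0 g1; rewrite [LHS]fiber_incl_fiber g0 g1 gmulf1 mul1g. Qed.

End DihedralArtin.

Theorem mainTheorem10 (m : nat) (hm : 5 <= m) : locally_indicable (artin_I2 m).
Proof.
case: m hm => [|[|[|k]]] // _ H Hcl _ [x xH xn1].
have [[y yH yn0]|len0] := pselect (exists2 y, y \in H & artin_len y != 0%R).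
  by exists (@artin_len k); split; [move=> g h _ _; apply: artin_lenM | exists y].
have lenH g : g \in H -> artin_len g = 0%R.
  by move=> gH; apply/eqP; apply: contra_notT len0 => gn0; exists g.
(* Now [H] lies in the kernel of the length, so its image [K] is a nontrivial subgroup of a free
   group, and a homomorphism on [K] pulls back to [H]. *)
pose K : {pred free_group 'I_k.+2} := [pred y | `[< exists2 g, g \in H & fiber g = y >]].
have fiberK g : g \in H -> fiber g \in K by move=> gH; apply/asboolP; exists g.
have Kcl : group_closed K.
  have [H1 HF] := Hcl; have HV := group_closedV Hcl.
  have fiber1 : fiber (1 : artin_I2 k.+3) = 1.
    by apply: (mulgI (fiber 1)); rewrite -fiberM ?lenH // !mulg1.
  split; first by rewrite -fiber1 fiberK.
  move=> _ _ /asboolP[g gH <-] /asboolP[h hH <-].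
  rewrite -[_^-1](_ : fiber h^-1 = _) -?fiberM ?lenH ?fiberK ?HF //.
  by apply/esym/mulg1_eq; rewrite -fiberM ?lenH // mulgV.
have [|f [fM [_ /asboolP[g gH <-] fg]]] := free_subgroup_hom Kcl.
  exists (fiber x); first exact: fiberK.
  by apply: contra xn1 => /eqP/(fiber_inj (lenH x xH)) ->.
exists (f \o @fiber k); split; last by exists g.
by move=> g1 g2 g1H g2H; rewrite /= fiberM ?lenH // fM ?fiberK.
Qed.
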